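(* Let $m\ge1$ be an integer, let $p,q\in\mathcal P_{2m}(\mathbb R)$, and suppose that $$\mathbf Q_m(\mathrm{Sym}(q))=\mathcal H_m\left[\begin{smallmatrix}1-\frac1{2m}\\ \cdot\end{smallmatrix}\right]\boxtimes_m r$$ for some $r\in\mathcal P_m(\mathbb R_{\ge0})$. Then $p\,\square_{2m}\,q\in\mathcal P_{2m}(\mathbb R)$.
   Context: $\mathcal P_n$ is the set of monic polynomials of degree $n$ over $\mathbb C$; for $K\subseteq\mathbb C$, $\mathcal P_n(K)$ is the subset of those with all roots in $K$. For $p\in\mathcal P_n$ the coefficients $\mathsf e_k(p)$ are defined by $p(x)=\sum_{k=0}^n x^{n-k}(-1)^k\mathsf e_k(p)$. For a nonzero scalar $\alpha$, $[\operatorname{Dil}_\alpha p](x)=\alpha^np(\alpha^{-1}x)$. Falling factorial: $(a)^{\underline k}=a(a-1)\cdots(a-k+1)$. Finite free convolutions on $\mathcal P_n$, for $0\le k\le n$: $\mathsf e_k(p\boxplus_n q)=(n)^{\underline k}\sum_{i+j=k}\frac{\mathsf e_i(p)\mathsf e_j(q)}{(n)^{\underline i}(n)^{\underline j}}$ and $\mathsf e_k(p\boxtimes_n q)=\binom nk^{-1}\mathsf e_k(p)\mathsf e_k(q)$. The symmetrization of $p\in\mathcal P_n$ is $\mathrm{Sym}(p)=p\boxplus_n(\operatorname{Dil}_{-1}p)$. The map $\mathbf Q_m:\mathcal P_{2m}\to\mathcal P_m$ is defined by $\mathsf e_k(\mathbf Q_m(p))=(-1)^k\mathsf e_{2k}(p)$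 for $0\le k\le m$. The polynomial $\mathcal H_m\left[\begin{smallmatrix}b\\ \cdot\end{smallmatrix}\right]\in\mathcal P_m$ is the monic polynomial with $\mathsf e_k=\binom mk(mb)^{\underline k}$ for $0\le k\le m$. Finite free commutator: let $z_n(x)=\sum_{k=0}^{\lfloor n/2\rfloor}x^{n-2k}(-1)^k\binom n{2k}(n)^{\underline k}\frac{k!}{(2k)!}\frac{n+1-k}{n+1}$; for $p,q\in\mathcal P_n$, $p\,\square_n\,q=\mathrm{Sym}(p)\boxtimes_n\mathrm{Sym}(q)\boxtimes_n z_n$. *)

(* Defs.v *)
From HB Require Import structures.
From mathcomp Require Import all_boot all_order all_algebra.
From mathcomp Require Import complex reals.
Set Implicit Arguments.
Unset Strict Implicit.
Unset Printing Implicit Defensive.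
Import Order.TTheory GRing.Theory Num.Theory.
Local Open Scope ring_scope.

Section FiniteFree.
Variable F : fieldType.
Implicit Types (n m k : nat) (p q : {poly F}).

Definition monic_of_degree n p : bool := (p \is monic) && (size p == n.+1).

Definition monic_with_roots n (K : F -> Prop) p : Prop :=
  monic_of_degree n p /\ (forall z : F, root p z -> K z).

(* The degree n is passed explicitly to every operation below; the definitions
   are meant for arguments satisfying [monic_of_degree n]. *)

Definition ecoef n k p : F := (-1) ^+ k * p`_(n - k).

(* Only the values e 0, ..., e n are used; the result is monic of degree n
   when e 0 = 1. *)
Definition poly_of_ecoef n (e : nat -> F) : {poly F} :=
  \sum_(k < n.+1) ((-1) ^+ k * e k) *: 'X^(n - k).

(* Falling factorial with an arbitrary base; for a natural base the library's
   [n ^_ k] is used. *)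
Definition falling (a : F) k : F := \prod_(i < k) (a - i%:R).

Definition dilation n (a : F) p : {poly F} := a ^+ n *: (p \Po (a^-1 *: 'X)).

Definition ffadd n p q : {poly F} :=
  poly_of_ecoef n (fun k =>
    (n ^_ k)%:R *
    \sum_(i < k.+1) (ecoef n i p * ecoef n (k - i) q)
                    / ((n ^_ i)%:R * (n ^_ (k - i))%:R)).

Definition ffmul n p q : {poly F} :=
  poly_of_ecoef n (fun k => ('C(n, k)%:R)^-1 * ecoef n k p * ecoef n k q).

Definition symmetrization n p : {poly F} := ffadd n p (dilation n (-1) p).

Definition evenQ m p : {poly F} :=
  poly_of_ecoef m (fun k => (-1) ^+ k * ecoef (2 * m) (2 * k) p).

Definition hypergeomH m (b : F) : {poly F} :=
  poly_of_ecoef m (fun k => 'C(m, k)%:R * falling (m%:R * b) k).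

Definition commz n : {poly F} :=
  \sum_(k < n./2.+1)
    ((-1) ^+ k * 'C(n, 2 * k)%:R * (n ^_ k)%:R
     * ((k`!)%:R / ((2 * k)`!)%:R)
     * ((n.+1 - k)%:R / n.+1%:R)) *: 'X^(n - 2 * k).

Definition ffcomm n p q : {poly F} :=
  ffmul n (ffmul n (symmetrization n p) (symmetrization n q)) (commz n).

Lemma coef_poly_of_ecoef n e k :
  (k <= n)%N -> (poly_of_ecoef n e)`_(n - k) = (-1) ^+ k * e k.
Proof.
move=> kn; rewrite /poly_of_ecoef coef_sum (bigD1 (Ordinal (kn : k < n.+1)%N)) //=.
rewrite coefZ coefXn eqxx mulr1 big1 ?addr0 // => i neq_ik.
rewrite coefZ coefXn eqn_sub2lE ?leq_ord //.
by rewrite -[k]/(val (Ordinal (kn : k < n.+1)%N)) val_eqE eq_sym (negPf neq_ik) mulr0.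
Qed.

Lemma ecoefK n e k : (k <= n)%N -> ecoef n k (poly_of_ecoef n e) = e k.
Proof. by move=> kn; rewrite /ecoef coef_poly_of_ecoef // signrMK. Qed.

Lemma poly_of_ecoefK n p :
  monic_of_degree n p -> poly_of_ecoef n (ecoef n ^~ p) = p.
Proof.
case/andP=> _ /eqP sp; apply/polyP => j; have [jn|nj] := leqP j n.
  rewrite -(subKn jn) coef_poly_of_ecoef ?leq_subr //.
  by rewrite /ecoef signrMK.
rewrite [RHS]nth_default ?sp // coef_sum big1 // => i _.
rewrite coefZ coefXn gtn_eqF ?mulr0 //.
exact: leq_ltn_trans (leq_subr _ _) nj.
Qed.

End FiniteFree.

(* In the partial order of R[i], 0 <= z means that z is real and nonnegative. *)
Definition real_line (R : realType) (z : R[i]) : Prop := z \is Num.real.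
Definition nonneg_reals (R : realType) (z : R[i]) : Prop := 0 <= z.

(* Main.v *)
Require Import Defs.
From HB Require Import structures.
From mathcomp Require Import all_boot all_order all_algebra.
From mathcomp Require Import complex reals.
From mathcomp Require Import ring zify.
Set Implicit Arguments.
Unset Strict Implicit.
Unset Printing Implicit Defensive.
Import Order.TTheory GRing.Theory Num.Theory.
Local Open Scope ring_scope.

(** Put N = 2m.  A symmetrization is an even polynomial s, so s(x) = Q(x^2)
    with Q = evenQ m s, and s is real-rooted exactly when Q has nonnegative
    roots.  Comparing coefficients, and using
      4^j m^_j falling(m - 1/2, j) = (2m)^_(2j)
    to cancel the factor falling(m - 1/2, j) that the hypothesis puts into
    the coefficients of evenQ m (Sym q), one finds, up to a nonzero constant,
      (p [] q)(x) = W(4 x^2),   W = evenQ m (Sym p) * r * G * L,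
    where the products are finite free multiplicative convolutions in degree m
    and
      e_k(G) = C(m,k) N^_k,     e_k(L) = C(m,k) (N + 1 - k) / (N + 1).
    It remains to see that W has nonnegative roots.

    - The additive convolution preserves real-rootedness and the multiplicative
      one preserves nonnegative-rootedness ([ffadd_real_rooted],
      [ffmul_nonneg_rooted]).  Both follow from Grace's theorem for a half-plane
      ([apolar_neq0]): if f has no root in an open half-plane and g has all its
      roots there, then f and g are not apolar.  Up to a constant, the value at
      z of the additive convolution of p and q is the apolar pairing of p(X)
      with q(z - X), and the value of their multiplicative convolution is that
      of X^n q(z/X) with p(X); a z outside the expected root set provides a
      half-plane which separates the roots of the two paired polynomials.
    - Grace's theorem is obtained by iterating Laguerre's theorem on polar
      derivatives ([polar_roots]), one step for each root of g.
    - X^(N - m) G is (1 - D)^m X^N, which is real-rooted because 1 - D preserves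
      real-rootedness ([sub_deriv_real_roots]); its signs alternate, so the
      roots of G are nonnegative.  The polynomial L is
      explicit: (N + 1) L = (X - 1)^(m-1) ((N + 1) X - (N + 1 - m)).

    The inequalities behind Laguerre's theorem and behind 1 - D both come
    from [norm_log_derivative]: with F the monic polynomial whose roots, with
    multiplicity, are a_1, ..., a_d,
      d + v F'(x)/F(x) = sum_i (x + v - a_i) / (x - a_i),
    and each term has norm at most 1 when x + v is the reflection of x in the
    boundary of a half-plane that contains the roots but not x. *)

(** * Grace's theorem for a half-plane *)

Section HalfPlane.
Variable C : numClosedFieldType.
Implicit Types (p f g : {poly C}) (s : seq C) (x z c h : C).

Lemma normC2_reflect (u d : C) : d \is Num.real ->
  `|u - d *+ 2| ^+ 2 = `|u| ^+ 2 - (d * ('Re u - d)) *+ 4.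
Proof.
move=> dR; rewrite !normC2_Re_Im !raddfB /= !raddfMn /=.
have -> : 'Re d = d by apply/Creal_ReP.
have -> : 'Im d = 0 by apply/Creal_ImP.
by ring.
Qed.

Lemma le_norm_reflect (u d : C) : 0 <= d -> d <= 'Re u ->
  `|u - d *+ 2| <= `|u|.
Proof.
move=> d0 dle; rewrite -(@ler_pXn2r _ 2) ?nnegrE //.
rewrite normC2_reflect ?ger0_real // gerBl mulrn_wge0 //.
by rewrite mulr_ge0 // subr_ge0.
Qed.

Lemma gt_norm_reflect (u d : C) : 0 < d -> 'Re u < d ->
  `|u| < `|u - d *+ 2|.
Proof.
move=> d0 dlt; rewrite -(@ltr_pXn2r _ 2) ?nnegrE //.
rewrite normC2_reflect ?gtr0_real // ltrBrDl gtrDr.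
by rewrite pmulrn_llt0 // pmulr_rlt0 // subr_lt0.
Qed.

(** The identity d F + v F' = sum_i (x + v - a_i) prod_(j != i) (x - a_j) for
    the monic polynomial F with roots a_1, ..., a_d, as a bound that needs no
    division by F(x). *)
Lemma norm_log_derivative s f x v :
  f = \prod_(a <- s) ('X - a%:P) ->
  (forall a, a \in s -> `|x + v - a| <= `|x - a|) ->
  `|f.[x] *+ size s + v * f^`().[x]| <= `|f.[x]| *+ size s.
Proof.
elim: s f => [|a s IHs] _ -> hs /=.
  by rewrite big_nil -polyC1 derivC !hornerE !mulr0n normr0.
have {}IHs := IHs _ erefl (fun b bs => hs b (mem_behead (s := a :: s) bs)).
rewrite big_cons; set f := \prod_(b <- s) _ in IHs *.
rewrite derivM derivB derivX derivC !hornerE subr0 mul1r.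
set F := f.[x] in IHs *; set F' := _.[x] in IHs *.
have -> : ((x - a) * F) *+ (size s).+1 + v * (F + (x - a) * F') =
  (x - a) * (F *+ size s + v * F') + (x + v - a) * F.
  by rewrite mulrS; ring.
apply: le_trans (ler_normD _ _) _; rewrite mulrS addrC !normrM lerD //.
  by rewrite -mulrnAr ler_wpM2l.
by rewrite ler_wpM2r // hs ?mem_head.
Qed.

(** The polar derivative n p - (X - z) p' of p with respect to z, where p has
    formal degree n; the result has formal degree n - 1. *)
Definition polar n z p : {poly C} := p *+ n - ('X - z%:P) * p^`().

Lemma coef_polar n z p k : (k <= n)%N ->
  (polar n z p)`_k = (n - k)%:R * p`_k + z * k.+1%:R * p`_k.+1.
Proof.
move=> kn; rewrite /polar coefB coefMn mulrBl coefB coefXM coefCM !coef_deriv.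
rewrite natrB //.
case: k kn => [|k] kn /=.
  by rewrite sub0r opprK !subr0 mulr1n mulr1 mulr_natl.
rewrite mulrBl !mulr_natl -mulrA mulr_natl opprB addrA.
by rewrite addrAC.
Qed.

Lemma size_polar n z p : (size p <= n.+2)%N -> (size (polar n.+1 z p) <= n.+1)%N.
Proof.
move=> sp; apply/leq_sizeP => j; rewrite leq_eqVlt => /predU1P[<-|jn].
  rewrite coef_polar // subnn mul0r add0r.
  by rewrite (nth_default _ sp) mulr0.
rewrite /polar coefB coefMn mulrBl coefB coefXM coefCM !coef_deriv.
case: j jn => //= j jn.
rewrite !(nth_default _ (leq_trans sp _)) ?(leqW jn) //.
by rewrite !mul0rn mulr0 !subr0.
Qed.

(** Laguerre's theorem for the closed half-plane Re(c w) <= h.  The actual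
    degree of p may be less than n+1: the missing roots are at infinity, which
    belongs to the closed half-plane. *)
Lemma polar_roots n c h z p : c != 0 -> h \is Num.real -> p != 0 ->
  (size p <= n.+2)%N ->
  (forall a, root p a -> 'Re (c * a) <= h) -> h < 'Re (c * z) ->
  polar n.+1 z p != 0 /\
  (forall a, root (polar n.+1 z p) a -> 'Re (c * a) <= h).
Proof.
move=> c0 hR p0 sp hp hz.
have nroot x : h < 'Re (c * x) -> ~~ root (polar n.+1 z p) x.
  move=> hx; have [r def_p] := closed_field_poly_normal p.
  have lc0 : lead_coef p != 0 by rewrite lead_coef_eq0.
  have px0 : p.[x] != 0 by apply/negP=> /hp; rewrite lt_geF.
  set d := 'Re (c * x) - h.
  have d0 : 0 < d by rewrite subr_gt0.
  (* x + v is the mirror image of x in the line Re(c w) = h. *)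
  set v := - (d / c) *+ 2.
  have cE y : c * (x + v - y) = c * (x - y) - d *+ 2.
    by rewrite addrAC mulrDr /v mulrnAr mulrN mulrCA mulfV // mulr1 mulNrn.
  have norm_c (y w : C) : (`|y| <= `|w|) = (`|c * y| <= `|c * w|).
    by rewrite !normrM ler_pM2l ?normr_gt0.
  have hr a : a \in r -> `|x + v - a| <= `|x - a|.
    move=> ar; rewrite norm_c cE le_norm_reflect ?(ltW d0) //.
    rewrite mulrBr raddfB /= /d lerD2l lerN2 hp //.
    by rewrite def_p rootZ // root_prod_XsubC.
  have hxz : `|x - z| < `|x + v - z|.
    suff: `|c * (x - z)| < `|c * (x + v - z)|.
      by rewrite !normrM ltr_pM2l ?normr_gt0.
    rewrite cE gt_norm_reflect // mulrBr raddfB /= /d ltrD2l ltrN2 //.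
  have sr : (size r <= n.+1)%N.
    by move: sp; rewrite def_p size_scale // size_prod_XsubC ltnS.
  have := norm_log_derivative erefl hr; set f := \prod_(a <- r) _ => ineq.
  apply/negP; rewrite /root /polar def_p -/f derivZ !hornerE.
  have -> : (lead_coef p *: f *+ n.+1).[x] - (x - z) * lead_coef p * f^`().[x] =
      lead_coef p * (f.[x] *+ n.+1 - (x - z) * f^`().[x]).
    by rewrite hornerMn hornerZ mulrBr mulrnAr (mulrC (x - z) (lead_coef p)) !mulrA.
  rewrite mulf_eq0 (negPf lc0) /= subr_eq0 => /eqP eq_f.
  have fx0 : f.[x] != 0.
    by apply: contraNneq px0 => fx0; rewrite def_p -/f !hornerE fx0 mulr0.
  (* Each of the missing n+1-d roots at infinity contributes a term of norm 1. *)
  have key : (x - z) * (f.[x] *+ size r + v * f^`().[x]) =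
    ((x + v - z) *+ n.+1 - (x - z) *+ (n.+1 - size r)) * f.[x].
    rewrite mulrDr mulrCA -eq_f mulrnBr //; ring.
  have : `|x + v - z| *+ n.+1 * `|f.[x]| <= `|x - z| *+ n.+1 * `|f.[x]|.
    have -> : `|x + v - z| *+ n.+1 * `|f.[x]| = `|((x + v - z) *+ n.+1) * f.[x]|.
      by rewrite normrM normrMn.
    have -> : (x + v - z) *+ n.+1 * f.[x] =
       (x - z) * (f.[x] *+ size r + v * f^`().[x]) +
       (x - z) *+ (n.+1 - size r) * f.[x] by rewrite key; ring.
    apply: le_trans (ler_normD _ _) _.
    rewrite !normrM normrMn.
    apply: le_trans (lerD (ler_wpM2l (normr_ge0 _) ineq) (lexx _)) _.
    by rewrite mulrnBr // -subr_ge0 le_eqVlt; apply/orP; left; apply/eqP; ring.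
  rewrite ler_pM2r ?normr_gt0 // lerMn2r /=.
  by rewrite lt_geF.
split=> [|a].
  by apply: contraNneq (nroot z hz) => ->; rewrite root0.
move=> ra; rewrite real_leNgt ?Creal_Re //; apply/negP => /nroot.
by rewrite ra.
Qed.

(** The apolar pairing of two polynomials of formal degree n.  The weights
    k! (n-k)! are those of the usual definition, 1 / C(n,k), multiplied by n!
    to avoid division. *)
Definition apolar n f g : C :=
  \sum_(k < n.+1) (-1) ^+ k * (k`! * (n - k)`!)%:R * f`_k * g`_(n - k).

(** Removing a root from the second argument amounts to taking a polar
    derivative of the first one. *)
Lemma apolar_MXsubC n z f g : (size g <= n.+1)%N ->
  apolar n.+1 f (('X - z%:P) * g) = apolar n (polar n.+1 z f) g.
Proof.
move=> sg; rewrite /apolar.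
under eq_bigr => k _ do
  rewrite mulrBl coefB coefXM coefCM mulrBr.
rewrite sumrB big_ord_recr /= subnn eqxx mulr0 addr0.
rewrite [X in _ - X]big_ord_recl /= subn0 (nth_default _ sg) mulr0 mulr0 add0r.
rewrite -sumrB; apply: eq_bigr => k _.
have kn : (k <= n)%N by rewrite -ltnS.
rewrite coef_polar 1?leqW // /bump /= add1n subSS subSn //= factS.
rewrite exprS (factS k) !natrM; ring.
Qed.

(** Grace's theorem for a half-plane. *)
Lemma apolar_neq0 c h s f : c != 0 -> h \is Num.real -> f != 0 ->
  (size f <= (size s).+1)%N ->
  (forall a, root f a -> 'Re (c * a) <= h) ->
  (forall z, z \in s -> h < 'Re (c * z)) ->
  apolar (size s) f (\prod_(z <- s) ('X - z%:P)) != 0.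
Proof.
move=> c0 hR; elim: s f => [|z s IHs] f f0 sf hf hs.
  rewrite big_nil /apolar big_ord1 /= subnn fact0 expr0 !mul1r coef1 mulr1.
  apply: contraNneq f0 => f00; apply/eqP/polyP=> i; rewrite coef0.
  by case: i => // i; rewrite nth_default // (leq_trans sf).
rewrite big_cons /= apolar_MXsubC; last by rewrite size_prod_XsubC.
have [g0 hg] := polar_roots c0 hR f0 sf hf (hs z (mem_head _ _)).
apply: IHs => //; first exact: size_polar.
by move=> y ys; apply: hs; rewrite inE ys orbT.
Qed.

End HalfPlane.

(** * Finite free convolutions and the apolar pairing *)

Section Convolutions.
Variable C : numClosedFieldType.
Implicit Types (p q f g : {poly C}) (s : seq C) (x z c h : C).

(** Monic of degree n, with real roots only. *)
Definition real_rooted n p := monic_with_roots n (fun z : C => z \is Num.real) p.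
(** Monic of degree n, with nonnegative real roots only. *)
Definition nonneg_rooted n p := monic_with_roots n (fun z : C => 0 <= z) p.

Lemma monic_with_rootsP n (K : C -> Prop) p : monic_with_roots n K p ->
  exists2 s, size s = n & p = \prod_(a <- s) ('X - a%:P) /\
   (forall a, a \in s -> K a).
Proof.
case=> /andP[/monicP lp /eqP sp] hK.
have [s def_p] := closed_field_poly_normal p.
rewrite lp scale1r in def_p; exists s.
  by move: sp; rewrite def_p size_prod_XsubC => -[].
split=> // a sa; apply: hK.
by rewrite def_p root_prod_XsubC.
Qed.

Lemma monic_poly_of_ecoef n (e : nat -> C) : e 0%N = 1 ->
  monic_of_degree n (poly_of_ecoef n e).
Proof.
move=> e0; have lc : (poly_of_ecoef n e)`_n = 1.
  by rewrite -[X in _`_X](subn0 n) coef_poly_of_ecoef // expr0 mul1r.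
have s_le : (size (poly_of_ecoef n e) <= n.+1)%N.
  apply/leq_sizeP => j nj; rewrite coef_sum big1 // => i _.
  by rewrite coefZ coefXn gtn_eqF ?mulr0 // (leq_ltn_trans (leq_subr _ _)).
have s_eq : size (poly_of_ecoef n e) = n.+1.
  apply/eqP; rewrite eqn_leq s_le ltnNge /=; apply/negP => s_n.
  by move/eqP: lc; rewrite nth_default // eq_sym oner_eq0.
by rewrite /monic_of_degree s_eq eqxx andbT monicE lead_coefE s_eq /= lc.
Qed.

Lemma horner_poly_of_ecoef n (e : nat -> C) x :
  (poly_of_ecoef n e).[x] = \sum_(k < n.+1) (-1) ^+ k * e k * x ^+ (n - k).
Proof.
by rewrite horner_sum; apply: eq_bigr => k _; rewrite hornerZ hornerXn.
Qed.

Lemma coef_ecoef n k p : (k <= n)%N -> p`_(n - k) = (-1) ^+ k * ecoef n k p.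
Proof. by move=> kn; rewrite /ecoef signrMK. Qed.

Lemma ecoef0 n p : monic_of_degree n p -> ecoef n 0 p = 1.
Proof.
case/andP=> /monicP lp /eqP sp.
by rewrite /ecoef expr0 mul1r subn0 -lp lead_coefE sp.
Qed.

Lemma horner_ecoef n p x : monic_of_degree n p ->
  p.[x] = \sum_(k < n.+1) (-1) ^+ k * ecoef n k p * x ^+ (n - k).
Proof. by move=> mp; rewrite -{1}(poly_of_ecoefK mp) horner_poly_of_ecoef. Qed.

Lemma monic_ffadd n p q : monic_of_degree n p -> monic_of_degree n q ->
  monic_of_degree n (ffadd n p q).
Proof.
move=> mp mq; apply: monic_poly_of_ecoef.
by rewrite big_ord1 /= !ecoef0 // !ffactn0 !mul1r invr1.
Qed.

Lemma monic_ffmul n p q : monic_of_degree n p -> monic_of_degree n q ->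
  monic_of_degree n (ffmul n p q).
Proof.
by move=> mp mq; apply: monic_poly_of_ecoef; rewrite bin0 invr1 !ecoef0 ?mulr1.
Qed.

Lemma ecoef_ffmul n p q k : (k <= n)%N ->
  ecoef n k (ffmul n p q) = 'C(n, k)%:R^-1 * ecoef n k p * ecoef n k q.
Proof. by move=> kn; rewrite ecoefK. Qed.

Lemma sum_triangle n (F : nat -> nat -> C) :
  \sum_(k < n.+1) \sum_(i < k.+1) F i (k - i)%N =
  \sum_(i < n.+1) \sum_(j < n.+1 | (i + j <= n)%N) F i j.
Proof.
transitivity (\sum_(k < n.+1) \sum_(i < n.+1 | (i <= k)%N) F i (k - i)%N).
  apply: eq_bigr => k _; rewrite (big_ord_widen n.+1 (fun i => F i (k - i)%N)) //.
rewrite (exchange_big_dep xpredT) //=; apply: eq_bigr => i _.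
have i_le : (i <= n)%N by rewrite -ltnS.
rewrite -(big_mkord (fun k => (i <= k)%N) (fun k => F i (k - i)%N)).
rewrite -(big_mkord (fun k => (i + k <= n)%N) (fun k => F i k)).
rewrite (big_cat_nat (n := i)) ?leqW //= big_nat_cond big_pred0 => [|k]; last first.
  by apply/negP=> /andP[/andP[_ ki]]; rewrite leqNgt ki.
rewrite Monoid.simpm -{1}[i : nat]add0n big_addn.
rewrite [RHS](big_cat_nat (n := (n.+1 - i)%N)) ?leq_subr //=.
rewrite [X in _ = _ + X]big_nat_cond [X in _ = _ + X]big_pred0 => [|k]; last first.
  by apply/negP=> /andP[/andP[]]; lia.
rewrite addr0 big_nat_cond [RHS]big_nat_cond.
apply: eq_big => [k|k _]; last by rewrite addnK.
by apply/idP/idP; lia.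
Qed.

Lemma coef_XBexp z j l :
  ((z%:P - 'X) ^+ j)`_l = (-1) ^+ l * 'C(j, l)%:R * z ^+ (j - l) :> C.
Proof.
rewrite exprDn coef_sum.
have term (i : nat) : (z%:P ^+ (j - i) * (- 'X) ^+ i *+ 'C(j, i))`_l =
    if l == i then (-1) ^+ l * 'C(j, l)%:R * z ^+ (j - l) else 0 :> C.
  rewrite -scaleN1r exprZn coefMn -polyC_exp coefCM coefZ coefXn.
  case: eqVneq => [->|ne]; last by rewrite !mulr0 mul0rn.
  by rewrite mulr1 -[LHS]mulr_natr -mulrA mulrC mulrAC.
under eq_bigr => i _ do rewrite term.
have [lj|jl] := leqP l j.
  rewrite (bigD1 (Ordinal (lj : l < j.+1)%N)) //= eqxx big1 ?addr0 // => i ne.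
  by rewrite eq_sym -[l]/(val (Ordinal (lj : l < j.+1)%N)) val_eqE (negPf ne).
rewrite bin_small // mulr0 mul0r big1 // => i _.
by case: eqP => // def_l; move: jl; rewrite def_l ltnNge -ltnS ltn_ord.
Qed.

Lemma coef_comp_CB n p z l : (size p <= n.+1)%N ->
  (p \Po (z%:P - 'X))`_l =
    \sum_(j < n.+1) p`_j * ((-1) ^+ l * 'C(j, l)%:R * z ^+ (j - l)) :> C.
Proof.
move=> sp; rewrite coef_comp_poly.
under eq_bigr => j _ do rewrite coef_XBexp.
rewrite (big_ord_widen n.+1 (fun j => p`_j * ((-1) ^+ l * 'C(j, l)%:R * z ^+ (j - l)))) //.
rewrite big_mkcond; apply: eq_bigr => j _; case: ltnP => // hj.
by rewrite nth_default // mul0r.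
Qed.

Lemma ffact_add_eq n i j : (i + j <= n)%N ->
  ((n - i)`! * i`! * 'C(n - j, i) * (n ^_ i * n ^_ j) = n`! * n ^_ (i + j))%N.
Proof.
move=> ijn; have iN : (i <= n)%N by lia.
have jN : (j <= n)%N by lia.
have i_nj : (i <= n - j)%N by lia.
have f_gt0 := fact_gt0 (n - (i + j)).
apply/eqP; rewrite -(eqn_pmul2r f_gt0) -[X in _ == X]mulnA (ffact_fact ijn).
have f_nj : ('C(n - j, i) * (i`! * (n - (i + j))`!) = (n - j)`!)%N.
  by rewrite -(bin_fact i_nj) -subnDA addnC.
rewrite -[X in (_ == X * _)%N](ffact_fact iN) -[X in (_ == _ * X)%N](ffact_fact jN).
by rewrite -f_nj; apply/eqP; ring.
Qed.

(** The value of the additive convolution at z, as an apolar pairing of p(X)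
    with q(z - X). *)
Lemma apolar_comp_CB n p q z : monic_of_degree n p -> monic_of_degree n q ->
  apolar n p (q \Po (z%:P - 'X)) = (-1) ^+ n * n`!%:R * (ffadd n p q).[z].
Proof.
move=> mp mq; rewrite /apolar horner_poly_of_ecoef.
have sq : (size q <= n.+1)%N by case/andP: mq => _ /eqP->.
rewrite mulr_sumr.
pose F i j : C := (-1) ^+ n * n`!%:R *
  ((-1) ^+ (i + j) * ((n ^_ (i + j))%:R *
  (ecoef n i p * ecoef n j q / ((n ^_ i)%:R * (n ^_ j)%:R))) * z ^+ (n - (i + j))).
transitivity (\sum_(k < n.+1) \sum_(i < k.+1) F i (k - i)%N); last first.
  apply: eq_bigr => k _; rewrite !mulr_sumr mulr_suml mulr_sumr.
  by apply: eq_bigr => i _; rewrite /F subnKC // -ltnS.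
rewrite sum_triangle (reindex_inj rev_ord_inj) /=; apply: eq_bigr => i _.
have iN : (i <= n)%N by rewrite -ltnS.
rewrite subSS (subKn iN) (coef_comp_CB _ _ sq) (reindex_inj rev_ord_inj) /=.
rewrite [RHS]big_mkcond mulr_sumr /=; apply: eq_bigr => j _.
have jN : (j <= n)%N by rewrite -ltnS.
rewrite subSS !coef_ecoef //; case: ifP => [ijn|/negbT]; last first.
  by rewrite -ltnNge => nij; rewrite bin_small ?mulr0 ?mul0r ?mulr0 //; lia.
have f0 k : (k <= n)%N -> (n ^_ k)%:R != 0 :> C.
  by move=> kn; rewrite pnatr_eq0 -lt0n ffact_gt0.
have eqn := congr1 (fun x : nat => x%:R : C) (ffact_add_eq ijn).
rewrite /F subnDA [(n - j - i)%N]subnAC exprD -signr_odd oddB // signr_addb !signr_odd.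
move: eqn; rewrite !natrM => eqn.
have uu : (-1) ^+ i * (-1) ^+ i = 1 :> C by rewrite -expr2 sqrr_sign.
have d0 : (n ^_ i)%:R * (n ^_ j)%:R != 0 :> C by rewrite mulf_neq0 ?f0.
set u := (-1) ^+ i in uu *; set w := (-1) ^+ n; set t := (-1) ^+ j.
set zk := z ^+ _; set D := (n ^_ i)%:R * (n ^_ j)%:R in eqn d0 *.
set e := ecoef n i p; set e' := ecoef n j q.
have -> : w * n`!%:R * (u * t * ((n ^_ (i + j))%:R * (e * e' / D)) * zk)
  = (n`!%:R * (n ^_ (i + j))%:R) / D * (w * (u * t) * (e * e') * zk).
  by set D' := D^-1; move: D' (n`!%:R : C) ((n ^_ (i + j))%:R : C) => D' c1 c2; ring.
rewrite -eqn mulfK // -[RHS]mul1r -uu.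
move: ((n - i)`!%:R : C) (i`!%:R : C) ('C(n - j, i)%:R : C) => c1 c2 c3; ring.
Qed.

End Convolutions.

(** * Roots of finite free convolutions *)

Section Preservation.
Variable C : numClosedFieldType.
Implicit Types (p q f g : {poly C}) (s : seq C) (x z c h : C).

Lemma apolarZr n f a g : apolar n f (a *: g) = a * apolar n f g.
Proof.
by rewrite /apolar mulr_sumr; apply: eq_bigr => k _; rewrite coefZ mulrCA.
Qed.

Lemma prod_XsubC_reflect z s :
  \prod_(w <- [seq z - b | b <- s]) ('X - w%:P) =
  (-1) ^+ size s *: (\prod_(b <- s) ('X - b%:P) \Po (z%:P - 'X)).
Proof.
elim: s => [|b s IHs]; first by rewrite !big_nil expr0 scale1r comp_polyC.
rewrite !big_cons {}IHs comp_polyM comp_polyB comp_polyX comp_polyC /=.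
have -> : z%:P - 'X - b%:P = - ('X - (z - b)%:P) by rewrite polyCB; ring.
by rewrite exprS mulN1r mulNr scalerN scaleNr opprK scalerAr.
Qed.

Lemma Re_iM y x : y \is Num.real -> 'Re ('i * y * x) = - (y * 'Im x).
Proof. by move=> yR; rewrite -mulrA ReMil ImMl. Qed.

(** If z is not real, the roots z - b of q(z - X) all lie strictly on the same
    side of the real line, which contains the roots of p. *)
Lemma ffadd_real_rooted n p q :
  real_rooted n p -> real_rooted n q -> real_rooted n (ffadd n p q).
Proof.
move=> hp hq; have mp := proj1 hp; have mq := proj1 hq.
split=> [|z]; first exact: monic_ffadd.
have [s sz [def_q sR]] := monic_with_rootsP hq.
apply: contraTT => zR; set y := 'Im z.
have yR : y \is Num.real by exact: Creal_Im.
have y0 : y != 0 by apply: contraNneq zR => /Creal_ImP.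
(* For c = - i Im(z), Re(c w) = Im(z) Im(w). *)
have c0 : 'i * - y != 0 by rewrite mulf_neq0 ?neq0Ci ?oppr_eq0.
have p0 : p != 0 by rewrite monic_neq0 //; case/andP: mp.
have ReE x : 'Re ('i * - y * x) = y * 'Im x.
  by rewrite Re_iM ?rpredN // mulNr opprK.
have := @apolar_neq0 C ('i * - y) 0 [seq z - b | b <- s] p c0 (real0 _) p0.
rewrite size_map sz prod_XsubC_reflect -def_q apolarZr apolar_comp_CB //.
rewrite !mulf_eq0 /root !negb_or; case/(_ _ _ _)/and3P => //.
- by case/andP: mp => _ /eqP->.
- move=> a /(proj2 hp) aR; rewrite ReE.
  by have /Creal_ImP -> := aR; rewrite mulr0.
- move=> _ /mapP[b /sR bR ->]; rewrite ReE raddfB /=.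
  have /Creal_ImP -> := bR; rewrite subr0 -expr2.
  by rewrite lt_def expf_neq0 //= real_exprn_even_ge0.
Qed.

(** Finitely many roots in an open half-plane lie in a smaller closed one. *)
Lemma roots_strict_bound c f : f != 0 ->
  (forall a, root f a -> 'Re (c * a) < 0) ->
  exists h, [/\ h \is Num.real, h < 0 & forall a, root f a -> 'Re (c * a) <= h].
Proof.
move=> f0; have [s ->] := closed_field_poly_normal f.
have lc0 : lead_coef f != 0 by rewrite lead_coef_eq0.
move=> hs.
have {}hs a : a \in s -> 'Re (c * a) < 0.
  by move=> sa; apply: hs; rewrite rootZ // root_prod_XsubC.
suff [h [hR h0 hle]] : exists h,
    [/\ h \is Num.real, h < 0 & forall a, a \in s -> 'Re (c * a) <= h].
  by exists h; split=> // a; rewrite rootZ // root_prod_XsubC; apply: hle.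
elim: s hs => [|a s IHs] hs; first by exists (-1); split; rewrite ?rpredN1 ?oppr_lt0.
have [b sb|h [hR h0 hle]] := IHs; first by apply: hs; rewrite inE sb orbT.
have aR := Creal_Re (c * a).
have [ha|ha] := real_leP aR hR.
  exists h; split=> // b; rewrite inE => /predU1P[->//|]; exact: hle.
exists ('Re (c * a)); split=> // [|b]; first by rewrite hs ?mem_head.
by rewrite inE => /predU1P[->//|/hle /le_trans]; apply; apply: ltW.
Qed.

(** If z is not a nonnegative real number, z lies strictly on one side of a
    line through 0 whose other side, closed, contains the nonnegative half-line.
    The roots z/b (b a nonzero root of q) of X^n q(z/X) are then strictly on the
    side of z; moving the line slightly puts it strictly between them and the
    roots of p, even when 0 is among the latter. *)
Lemma ffmul_nonneg_rooted n p q :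
  nonneg_rooted n p -> nonneg_rooted n q -> nonneg_rooted n (ffmul n p q).
Proof.
move=> hp hq; have mp := proj1 hp; have mq := proj1 hq.
split=> [|z]; first exact: monic_ffmul.
have [s sz [def_p s_ge0]] := monic_with_rootsP hp.
apply: contraTT => z_lt0.
have z0 : z != 0 by apply: contraNneq z_lt0 => ->.
have [c [c0 hcz hc]] : exists c,
    [/\ c != 0, 'Re (c * z) < 0 & forall a, 0 <= a -> 0 <= 'Re (c * a)].
  have [zR|zR] := boolP (z \is Num.real).
    exists 1; split=> [||a a0]; first exact: oner_neq0.
      by rewrite mul1r; have /Creal_ReP -> := zR; rewrite real_ltNge ?real0.
    by rewrite mul1r; have /Creal_ReP -> := ger0_real a0.
  have yR := Creal_Im z.
  have y0 : 'Im z != 0 by apply: contraNneq zR => /Creal_ImP.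
  (* Here Re(c w) = - Im(z) Im(w), which vanishes on the real line. *)
  exists ('i * 'Im z); split; first by rewrite mulf_neq0 ?neq0Ci.
    by rewrite Re_iM // oppr_lt0 -expr2 lt_def expf_neq0 //= real_exprn_even_ge0.
  by move=> a /ger0_real/Creal_ImP a0; rewrite Re_iM // a0 mulr0 oppr0.
(* f is X^n q(z/X); its degree is less than n when 0 is a root of q. *)
set f := \poly_(k < n.+1) (q`_(n - k) * z ^+ (n - k)).
have lq : q`_n = 1 by case/andP: mq => /monicP <- /eqP; rewrite lead_coefE => ->.
have f0N : f`_0 != 0.
  by rewrite coef_poly /= subn0 lq mul1r expf_neq0.
have f0 : f != 0 by apply: contraNneq f0N => ->; rewrite coef0.
have sq : size q = n.+1 by case/andP: mq => _ /eqP.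
have f_root a : root f a -> 'Re (c * a) < 0.
  move=> fa; have a0 : a != 0.
    by apply: contraNneq f0N => a0; rewrite -horner_coef0 /root -{1}a0.
  have : root q (z / a).
    have f_eq : f.[a] = a ^+ n * q.[z / a].
      rewrite horner_poly horner_coef sq mulr_sumr (reindex_inj rev_ord_inj) /=.
      apply: eq_bigr => k _; have kn : (k <= n)%N by rewrite -ltnS.
      rewrite subSS (subKn kn) exprMn exprVn.
      have -> : a ^+ n = a ^+ (n - k) * a ^+ k by rewrite -exprD subnK.
      have : a ^+ k != 0 by rewrite expf_neq0.
      move: (a ^+ k) (a ^+ (n - k)) q`_k (z ^+ k) => A B u v A0.
      by rewrite mulrACA [A * _]mulrCA mulfV // mulr1 mulrC mulrA.
    by move: fa; rewrite /root f_eq mulf_eq0 expf_eq0 (negPf a0) andbF.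
  move=> /(proj2 hq) b0; set b := z / a in b0.
  have bN : b != 0 by rewrite mulf_neq0 ?invr_eq0.
  have -> : c * a = b^-1 * (c * z) by rewrite /b invf_div mulrCA divfK.
  rewrite ReMl ?ger0_real ?invr_ge0 // pmulr_rlt0 // invr_gt0.
  by rewrite lt_def bN.
have [h [hR h0 hle]] := roots_strict_bound f0 f_root.
have := @apolar_neq0 C c h s f c0 hR f0.
rewrite sz -def_p => /(_ _ hle) apol.
have -> : root (ffmul n p q) z = (apolar n f p == 0).
  have -> : apolar n f p = n`!%:R * (ffmul n p q).[z].
    rewrite horner_poly_of_ecoef mulr_sumr; apply: eq_bigr => k _.
    have kn : (k <= n)%N by rewrite -ltnS.
    rewrite coef_poly ltn_ord !coef_ecoef //.
    have C0 : 'C(n, k)%:R != 0 :> C by rewrite pnatr_eq0 -lt0n bin_gt0.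
    have /(congr1 (fun x : nat => x%:R : C)) := bin_fact kn.
    rewrite natrM => <-; have uu : (-1) ^+ k * (-1) ^+ k = 1 :> C.
      by rewrite -expr2 sqrr_sign.
    move: uu; set u := (-1) ^+ k => uu.
    move: ((k`! * (n - k)`!)%:R : C) (ecoef n k p) (ecoef n k q) (z ^+ _) => w e e' zk.
    move: ('C(n, k)%:R : C) C0 => b C0; rewrite -[RHS]mul1r -uu.
    have -> : u * u * (b * w * (u * (b^-1 * e * e') * zk)) =
       (b / b) * (u * u * (w * (u * (e * e') * zk))).
      by move: (b^-1) => b'; ring.
    by rewrite mulfV // mul1r; ring.
  by rewrite mulf_eq0 pnatr_eq0 gtn_eqF ?fact_gt0.
apply: apol => [|a /s_ge0 a0]; first exact: size_poly.
exact: lt_le_trans (hc a a0).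
Qed.
End Preservation.

(** * Two polynomials with nonnegative roots *)

Section Multipliers.
Variable C : numClosedFieldType.
Implicit Types (p q f g : {poly C}) (s : seq C) (x z c h : C).

(** The operator 1 - D preserves real-rootedness (Hermite and Poulain).  At
    a nonreal root x of f - f' which is not a root of f, the bound of
    [norm_log_derivative] with v = x^* - x, purely imaginary and nonzero,
    would give |d + v| <= d, where d is the degree of f. *)
Lemma sub_deriv_real_roots f : f != 0 ->
  (forall x, root f x -> x \is Num.real) ->
  f - f^`() != 0 /\ (forall x, root (f - f^`()) x -> x \is Num.real).
Proof.
move=> f0 hf; split.
  apply: contraNneq f0 => /eqP; rewrite subr_eq0 => /eqP ff'.
  have := @lt_size_deriv C f; rewrite -ff' ltnn.
  by case: eqVneq => // _ /(_ isT).
move=> x; have [fx|nfx] := boolP (root f x); first by move=> _; exact: hf.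
have [s def_f] := closed_field_poly_normal f.
have lc0 : lead_coef f != 0 by rewrite lead_coef_eq0.
have sR a : a \in s -> `|x + (x^* - x) - a| <= `|x - a|.
  move=> sa; have /hf/CrealP aR : root f a by rewrite def_f rootZ // root_prod_XsubC.
  by rewrite [x + _]addrC subrK -[X in _ - X]aR -rmorphB norm_conjC.
have := norm_log_derivative erefl sR; set g := \prod_(a <- s) _.
rewrite def_f derivZ -scalerBr rootZ // -/g /root !hornerE subr_eq0 => + /eqP gg'.
rewrite -gg' -mulr_natl -mulrDl normrM -[X in _ <= X]mulr_natl.
have g0 : 0 < `|g.[x]|.
  by rewrite normr_gt0; move: nfx; rewrite {1}def_f rootZ.
rewrite ler_pM2r // -(@ler_pXn2r _ 2) ?nnegrE ?ler0n //.
have yR : 'Im x *+ 2 \is Num.real by rewrite rpredMn ?Creal_Im.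
have -> : x^* - x = 'i * - ('Im x *+ 2).
  rewrite {1 2}[x]Crect conjC_rect ?Creal_Re ?Creal_Im //.
  by rewrite mulrN mulrnAr; ring.
rewrite normC2_rect ?rpred_nat ?rpredN ?yR //.
rewrite gerDl sqrrN => le0.
have ge0 := real_exprn_even_ge0 (n := 2) yR isT.
have : ('Im x *+ 2) ^+ 2 == 0 by rewrite eq_le le0 ge0.
by rewrite expf_eq0 mulrn_eq0 /= => /eqP/Creal_ImP.
Qed.

Lemma iter_sub_deriv n f :
  iter n (fun g => g - g^`()) f =
  \sum_(k < n.+1) ((-1) ^+ k * 'C(n, k)%:R) *: f^`(k).
Proof.
elim: n => [|n IHn]; first by rewrite big_ord1 /= bin0 mulr1 expr0 scale1r.
rewrite iterS IHn raddf_sum /= [in RHS]big_ord_recl /= bin0 mulr1 expr0 scale1r.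
under [X in _ = _ + X]eq_bigr => k _ do
  rewrite /bump add1n binS natrD mulrDr scalerDl.
rewrite big_split /= addrA; congr (_ + _).
  rewrite big_ord_recl /= bin0 mulr1 expr0 scale1r big_ord_recr /=.
  by rewrite bin_small // mulr0 scale0r addr0.
rewrite -sumrN; apply: eq_bigr => k _.
by rewrite derivZ -derivnS exprS mulN1r mulNr scaleNr.
Qed.

Lemma nonneg_rooted_ecoef n f : real_rooted n f ->
  (forall k, (k <= n)%N -> 0 <= ecoef n k f) -> nonneg_rooted n f.
Proof.
case=> mf hf e_ge0; split=> // x fx; have xR := hf x fx.
rewrite real_leNgt ?real0 //; apply/negP => x0.
move: fx; rewrite /root (horner_ecoef _ mf) => /eqP.
move/(congr1 (fun y => (-1) ^+ n * y)); rewrite mulr0 mulr_sumr.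
rewrite big_ord_recl /= ecoef0 // expr0 !mul1r subn0 -exprNn => /eqP.
have x0n : 0 < (- x) ^+ n by rewrite exprn_gt0 // oppr_gt0.
rewrite gt_eqF //; apply: ltr_wpDr => //; apply: sumr_ge0 => k _.
have kn : (bump 0 k <= n)%N by rewrite /bump add1n.
move: (bump 0 k) kn => {}k kn.
have -> : (-1) ^+ n * ((-1) ^+ k * ecoef n k f * x ^+ (n - k)) =
   ecoef n k f * (- x) ^+ (n - k).
  rewrite (exprNn x).
  have -> : (-1) ^+ n = (-1) ^+ (n - k) * (-1) ^+ k :> C by rewrite -exprD subnK.
  have : (-1) ^+ k * (-1) ^+ k = 1 :> C by rewrite -expr2 sqrr_sign.
  move: ((-1) ^+ k) => u uu; rewrite -[RHS]mul1r -uu; ring.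
by rewrite mulr_ge0 ?e_ge0 // exprn_ge0 // oppr_ge0 ltW.
Qed.

(** Multiplied by X^(N-n), this polynomial is (1 - D)^n X^N; it is a generalized
    Laguerre polynomial. *)
Lemma laguerre_nonneg_rooted n N : (n <= N)%N ->
  nonneg_rooted n (poly_of_ecoef n (fun k => 'C(n, k)%:R * (N ^_ k)%:R : C)).
Proof.
move=> nN; set e := fun k => _.
have mG : monic_of_degree n (poly_of_ecoef n e).
  by apply: monic_poly_of_ecoef; rewrite /e bin0 ffactn0 mulr1.
apply: nonneg_rooted_ecoef => [|k kn]; last by rewrite ecoefK // mulr_ge0.
split=> // x Gx.
have iterR j : let g := iter j (fun g => g - g^`()) ('X^N : {poly C}) in
    g != 0 /\ (forall x, root g x -> x \is Num.real).
  elim: j => [|j [IH0 IHr]] /=; last exact: sub_deriv_real_roots.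
  split=> [|y]; first by rewrite monic_neq0 ?monicXn.
  by rewrite /root hornerXn expf_eq0 => /andP[_ /eqP->].
have [_] := iterR n; apply; rewrite iter_sub_deriv.
suff -> : \sum_(k < n.+1) ((-1) ^+ k * 'C(n, k)%:R) *: ('X^N)^`(k) =
    'X^(N - n) * poly_of_ecoef n e :> {poly C}.
  by rewrite rootM Gx orbT.
rewrite mulr_sumr; apply: eq_bigr => k _; have kn : (k <= n)%N by rewrite -ltnS.
rewrite -scalerAr -exprD derivnXn -scaler_nat scalerA mulrA.
by congr (_ *: 'X^_); lia.
Qed.

(** Up to the factor N+1, this is (N+1-n) (X-1)^n + X ((X-1)^n)', which is
    (X-1)^(n-1) ((N+1) X - (N+1-n)). *)
Lemma shift_multiplier_nonneg_rooted n N : (0 < n <= N)%N ->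
  nonneg_rooted n
    (poly_of_ecoef n (fun k => 'C(n, k)%:R * ((N.+1 - k)%:R / N.+1%:R) : C)).
Proof.
case/andP=> n0 nN; have N0 : N.+1%:R != 0 :> C by rewrite pnatr_eq0.
split=> [|x]; first by apply: monic_poly_of_ecoef; rewrite bin0 subn0 divff ?mulr1.
rewrite /root horner_poly_of_ecoef => /eqP Lx.
have key : (N.+1 - n)%:R * (x - 1) ^+ n + n%:R * x * (x - 1) ^+ n.-1 = 0.
  have A_eq : ('X - 1) ^+ n =
      \sum_(k < n.+1) ((-1) ^+ k * 'C(n, k)%:R) *: 'X^(n - k) :> {poly C}.
    rewrite exprBn; apply: eq_bigr => k _.
    rewrite expr1n mulr1 -scaler_nat [_ * 'C(n, k)%:R]mulrC -scalerA.
    by congr (_ *: _); rewrite -mul_polyC polyC_exp polyCN.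
  have A_x := congr1 (fun g => g.[x]) A_eq.
  have A'_x := congr1 (fun g => x * g^`().[x]) A_eq.
  move: A_x A'_x; rewrite /= deriv_exp derivB derivX -polyC1 derivC subr0.
  rewrite mul1r hornerMn horner_exp !hornerE /= => A_x A'_x.
  rewrite -mulrA (mulrCA n%:R) (mulr_natl _ n) A'_x A_x.
  rewrite raddf_sum /= !horner_sum !mulr_sumr -big_split /=.
  rewrite -[RHS](mulr0 N.+1%:R) -[X in _ = _ * X]Lx mulr_sumr.
  apply: eq_bigr => k _; have kn : (k <= n)%N by rewrite -ltnS.
  rewrite derivZ derivXn !hornerZ hornerMn !hornerXn.
  have -> : x * ((-1) ^+ k * 'C(n, k)%:R * (x ^+ (n - k).-1 *+ (n - k))) =
     (n - k)%:R * ((-1) ^+ k * 'C(n, k)%:R * x ^+ (n - k)).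
    case: (n - k)%N => [|j] /=; first by rewrite mulr0n !mulr0 mul0r.
    by rewrite -mulr_natl exprS; ring.
  rewrite -mulrDl -natrD.
  have -> : (N.+1 - n + (n - k) = N.+1 - k)%N by lia.
  move: (N.+1%:R : C) N0 ((N.+1 - k)%:R : C) ('C(n, k)%:R : C) => a a0 u v.
  by move: ((-1) ^+ k) (x ^+ _) => w y; field.
move: key; case: n n0 nN {Lx} => // n _ nN /=.
rewrite exprS mulrA -mulrDl => /eqP; rewrite mulf_eq0 => /orP[]; last first.
  by rewrite expf_eq0 subr_eq0 => /andP[_ /eqP->].
have -> : (N.+1 - n.+1)%:R * (x - 1) + n.+1%:R * x = N.+1%:R * x - (N - n)%:R.
  by rewrite subSS mulrBr mulr1 addrAC -mulrDl -natrD addnS subnK // ltnW.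
rewrite subr_eq0 => /eqP /(canRL (mulKf N0)) ->.
by rewrite mulr_ge0 ?invr_ge0.
Qed.

End Multipliers.

(** * Even polynomials, symmetrization and the commutator kernel *)

Section Commutator.
Variable C : numClosedFieldType.
Implicit Types (p q f g : {poly C}) (s : seq C) (x z c h : C).

Lemma dilationN1E n p : dilation n (-1) p = (-1) ^+ n *: (p \Po (0%:P - 'X)).
Proof. by rewrite /dilation invrN1 scaleN1r sub0r. Qed.

Lemma ecoef_dilationN1 n p k : monic_of_degree n p -> (k <= n)%N ->
  ecoef n k (dilation n (-1) p) = (-1) ^+ k * ecoef n k p.
Proof.
case/andP=> _ /eqP sp kn; rewrite /ecoef dilationN1E coefZ.
rewrite (@coef_comp_CB _ n) ?sp //.
have lt_nk : (n - k < n.+1)%N by rewrite ltnS leq_subr.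
rewrite (bigD1 (Ordinal lt_nk)) //= binn subnn expr0 mulr1 big1 => [|j ne].
  rewrite addr0 mulr1; congr (_ * _); rewrite mulrCA mulrC; congr (_ * _).
  by rewrite -{1}(subnKC kn) exprD -mulrA -expr2 sqrr_sign mulr1.
have [jl|lj|je] := ltngtP j (n - k)%N.
- by rewrite bin_small // mulr0 mul0r mulr0.
- by rewrite expr0n subn_eq0 leqNgt lj !mulr0.
- by case/eqP: ne; apply/val_inj.
Qed.

Lemma dilationN1_real_rooted n p : real_rooted n p ->
  real_rooted n (dilation n (-1) p).
Proof.
move=> hp; have [s sz [def_p sR]] := monic_with_rootsP hp.
have -> : dilation n (-1) p = \prod_(w <- [seq 0 - b | b <- s]) ('X - w%:P).
  by rewrite prod_XsubC_reflect sz -def_p dilationN1E.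
split=> [|x]; last first.
  by rewrite root_prod_XsubC => /mapP[b /sR bR ->]; rewrite sub0r rpredN.
by rewrite /monic_of_degree monic_prod_XsubC size_prod_XsubC size_map sz eqxx.
Qed.

Lemma symmetrization_real_rooted n p : real_rooted n p ->
  real_rooted n (symmetrization n p).
Proof. by move=> hp; apply/ffadd_real_rooted/dilationN1_real_rooted. Qed.

(** For odd k, the terms of index i and k - i of the convolution sum are
    opposite. *)
Lemma ecoef_symmetrization_odd n p k : monic_of_degree n p -> (k <= n)%N ->
  odd k -> ecoef n k (symmetrization n p) = 0.
Proof.
move=> mp kn ok; rewrite ecoefK //.
set S := \sum_(i < k.+1) _; suff -> : S = 0 by rewrite mulr0.
suff SN : S = - S.
  apply/eqP; have := addrN S; rewrite -{1}[X in _ + X]SN -mulr2n.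
  by move/eqP; rewrite mulrn_eq0.
rewrite {1}/S (reindex_inj rev_ord_inj) -sumrN; apply: eq_bigr => i _ /=.
have ik : (i <= k)%N by rewrite -ltnS.
rewrite subSS (subKn ik) !ecoef_dilationN1 ?(leq_trans _ kn) ?leq_subr //.
rewrite (mulrC (n ^_ (k - i))%:R) -mulNr; congr (_ / _).
have -> : (-1) ^+ i = - (-1) ^+ (k - i) :> C.
  have : (-1) ^+ (k - i) * (-1) ^+ i = -1 :> C.
    by rewrite -exprD subnK // -signr_odd ok expr1.
  move/(congr1 (fun y => (-1) ^+ (k - i) * y)).
  by rewrite mulrA -expr2 sqrr_sign mul1r mulrN1.
by move: ((-1) ^+ (k - i)) (ecoef n _ p) (ecoef n i p) => u a b; ring.
Qed.

Lemma sum_even_terms m (F : nat -> C) :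
  (forall k, (k <= 2 * m)%N -> odd k -> F k = 0) ->
  \sum_(k < (2 * m).+1) F k = \sum_(j < m.+1) F (2 * j)%N.
Proof.
elim: m => [|m IHm] F0; first by rewrite muln0 !big_ord1 muln0.
rewrite [RHS]big_ord_recr /= -IHm => [|k km]; last by apply: F0; lia.
rewrite mulnS !big_ord_recr /= [in X in _ + X + _]F0 ?addr0 //; first lia.
by rewrite /= oddM.
Qed.

Lemma horner_evenQ m f x : monic_of_degree (2 * m) f ->
  (forall k, (k <= 2 * m)%N -> odd k -> ecoef (2 * m) k f = 0) ->
  f.[x] = (evenQ m f).[x ^+ 2].
Proof.
move=> mf odd0; rewrite (horner_ecoef _ mf) horner_poly_of_ecoef.
rewrite (sum_even_terms (F := fun k => (-1) ^+ k * ecoef (2 * m) k f * x ^+ (2 * m - k))).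
  apply: eq_bigr => j _; move: (ecoef _ _ f) => e.
  rewrite -exprM mulnBr exprM sqrrN expr1n expr1n.
  by rewrite [in RHS]mulrA -expr2 sqrr_sign.
by move=> k km ok; rewrite odd0 // mulr0 mul0r.
Qed.

Lemma evenQ_nonneg_rooted m f : real_rooted (2 * m) f ->
  (forall k, (k <= 2 * m)%N -> odd k -> ecoef (2 * m) k f = 0) ->
  nonneg_rooted m (evenQ m f).
Proof.
case=> mf hf odd0; split=> [|y].
  by apply: monic_poly_of_ecoef; rewrite muln0 expr0 mul1r ecoef0.
rewrite /root -[y]sqrtCK -horner_evenQ // => /hf yR.
by rewrite real_exprn_even_ge0.
Qed.

Lemma sqr_ge0_real x : 0 <= x ^+ 2 -> x \is Num.real.
Proof.
move=> /sqrtC_real sR; have := sqrtCK (x ^+ 2).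
by move/eqP; rewrite eqf_sqr => /orP[] /eqP e; move: sR; rewrite e ?rpredN.
Qed.

Lemma ecoef_commz n k : (k <= n)%N -> ecoef n k (commz C n) =
  if odd k then 0 else
    'C(n, k)%:R * (n ^_ k./2)%:R * ((-1) ^+ k./2 *
     ((k./2)`!%:R / k`!%:R * ((n.+1 - k./2)%:R / n.+1%:R))).
Proof.
move=> kn; rewrite /ecoef coef_sum.
case: ifPn => [ok|ek].
  rewrite big1 ?mulr0 // => i _; rewrite coefZ coefXn.
  case: eqP => [e|]; last by rewrite mulr0.
  by exfalso; have := ltn_ord i; lia.
have k2 : (2 * k./2 = k)%N by rewrite mul2n even_halfK.
have lt_k : (k./2 < n./2.+1)%N by rewrite ltnS half_leq.
rewrite (bigD1 (Ordinal lt_k)) //= big1 => [|i ne].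
  rewrite addr0 coefZ coefXn k2 eqxx mulr1 -signr_odd (negPf ek) expr0 mul1r.
  by ring.
rewrite coefZ coefXn; case: eqP => [e|]; last by rewrite mulr0.
case/eqP: ne; apply/val_inj => /=; have i_n := ltn_ord i; lia.
Qed.

(** (2m)^_(2j) split into its even and odd factors; the base of the falling
    factorial is m - 1/2. *)
Lemma falling_half m j : (0 < m)%N -> (j <= m)%N ->
  4 ^+ j * (m ^_ j)%:R * falling (m%:R * (1 - (2 * m)%:R^-1)) j =
  ((2 * m) ^_ (2 * j))%:R :> C.
Proof.
move=> m0; have mC : m%:R != 0 :> C by rewrite pnatr_eq0 -lt0n.
elim: j => [|j IHj] jm; first by rewrite /falling big_ord0 muln0 !ffactn0 expr0 !mul1r.
rewrite mulnS !ffactnSr /falling big_ord_recr /= -/(falling _ j) !natrM -IHj 1?ltnW //.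
rewrite exprSr !natrB; try lia.
rewrite -[in X in _ = _ * X]natr1 !natrM.
by move: (falling _ j) (4 ^+ j : C) ((m ^_ j)%:R : C) => u v w; field.
Qed.
End Commutator.

(** * The finite free commutator *)

Section Main.
Variable C : numClosedFieldType.
Implicit Types (p q f g : {poly C}) (s : seq C) (x z c h : C).

(** The powers of 4 are what makes the commutator a dilation, in x^2, of a
    multiplicative convolution in degree m. *)
Lemma ffcomm_weight m j : (0 < m)%N -> (j <= m)%N ->
  'C(2 * m, 2 * j)%:R^-1 * falling (m%:R * (1 - (2 * m)%:R^-1)) j *
    (j`!%:R / (2 * j)`!%:R) = 4 ^- j * 'C(m, j)%:R^-1 :> C.
Proof.
move=> m0 jm; have := @falling_half C m j m0 jm.
rewrite -!bin_ffact !natrM.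
have bin0 n k : (k <= n)%N -> 'C(n, k)%:R != 0 :> C.
  by move=> kn; rewrite pnatr_eq0 -lt0n bin_gt0.
have := bin0 _ _ jm; have /bin0 : (2 * j <= 2 * m)%N by lia.
have fact0 n : n`!%:R != 0 :> C by rewrite pnatr_eq0 -lt0n fact_gt0.
have := fact0 (2 * j)%N; have four0 : 4 ^+ j != 0 :> C by rewrite expf_neq0 ?pnatr_eq0.
move: (falling _ j) (4 ^+ j : C) four0 ((2 * j)`!%:R : C) (j`!%:R : C) => F u u0 v w v0.
move: ('C(m, j)%:R : C) ('C(2 * m, 2 * j)%:R : C) => b B B0 b0 e.
have -> : B^-1 * F * (w / v) = (u * (b * w) * F) / (u * b * (B * v)).
  by field; rewrite u0 b0 v0 B0.
by rewrite e; field; rewrite u0 b0 v0 B0.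
Qed.

Lemma ecoef_evenQ m f k : (k <= m)%N ->
  ecoef m k (evenQ m f) = (-1) ^+ k * ecoef (2 * m) (2 * k) f.
Proof. by move=> km; rewrite ecoefK. Qed.

Lemma ecoef_hypergeomH m b k : (k <= m)%N ->
  ecoef m k (hypergeomH m b) = 'C(m, k)%:R * falling (m%:R * b) k :> C.
Proof. by move=> km; rewrite ecoefK. Qed.

(** Real-rootedness of the commutator, over any algebraically closed field with
    a norm. *)
Lemma ffcomm_real_rooted m p q r : (0 < m)%N ->
  real_rooted (2 * m) p -> monic_of_degree (2 * m) q -> nonneg_rooted m r ->
  evenQ m (symmetrization (2 * m) q) =
    ffmul m (hypergeomH m (1 - (2 * m)%:R^-1)) r ->
  real_rooted (2 * m) (ffcomm (2 * m) p q).
Proof.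
move=> m0 hp mq hr hqr; set N := (2 * m)%N; set sp := symmetrization N p.
have hsp : real_rooted N sp by exact: symmetrization_real_rooted.
have msp := proj1 hsp.
have sp_odd k : (k <= N)%N -> odd k -> ecoef N k sp = 0.
  by apply: ecoef_symmetrization_odd; case: hp.
set sq := symmetrization N q in hqr.
have sq0 : ecoef N 0 sq = 1.
  rewrite /sq ecoefK // big_ord1 /= !ffactn0 subn0 !mul1r invr1 mulr1.
  by rewrite ecoef_dilationN1 // !ecoef0 // expr0 !mulr1.
have even_le k : (k <= m)%N -> (2 * k <= N)%N by rewrite leq_mul2l.
(* The value of the commutator at x is 4^-m W(4 x^2). *)
set W := ffmul m (ffmul m (evenQ m sp) r)
  (ffmul m (poly_of_ecoef m (fun k => 'C(m, k)%:R * (N ^_ k)%:R))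
    (poly_of_ecoef m (fun k => 'C(m, k)%:R * ((N.+1 - k)%:R / N.+1%:R)))).
have hW : nonneg_rooted m W.
  do 2?apply: ffmul_nonneg_rooted => //.
  - exact: evenQ_nonneg_rooted.
  - by apply: laguerre_nonneg_rooted; rewrite /N; lia.
  - by apply: shift_multiplier_nonneg_rooted; rewrite /N; lia.
have mono : monic_of_degree N (ffcomm N p q).
  apply: monic_poly_of_ecoef; rewrite bin0 invr1 mul1r ecoefK // bin0 invr1 mul1r.
  rewrite -/sp -/sq sq0 ecoef0 // ecoef_commz //= bin0 ffactn0 subn0 fact0 expr0.
  by rewrite !mul1r invr1 !mul1r divff ?pnatr_eq0.
have fc_odd k : (k <= N)%N -> odd k -> ecoef N k (ffcomm N p q) = 0.
  by move=> kN ok; rewrite ecoef_ffmul // ecoef_commz // ok mulr0.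
have key k : (k <= m)%N ->
    (-1) ^+ k * ecoef N (2 * k) (ffcomm N p q) = 4 ^- k * ecoef m k W.
  move=> km; have kN := even_le k km.
  have := congr1 (ecoef m k) hqr.
  rewrite ecoef_evenQ // ecoef_ffmul // ecoef_hypergeomH // -/N => hk.
  rewrite ![ecoef m k _]ecoef_ffmul // ecoef_evenQ // -/N.
  rewrite -/sp !(ecoefK _ km).
  rewrite [ecoef N _ _]ecoef_ffmul // ecoef_commz // ecoef_ffmul // -/sp -/sq.
  rewrite mul2n odd_double doubleK -mul2n.
  have bin0 n j : (j <= n)%N -> 'C(n, j)%:R != 0 :> C.
    by move=> jn; rewrite pnatr_eq0 -lt0n bin_gt0.
  have := ffcomm_weight m0 km; rewrite -/N.
  have := bin0 _ _ km; have := bin0 _ _ kN.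
  have uu : (-1) ^+ k * (-1) ^+ k = 1 :> C by rewrite -expr2 sqrr_sign.
  move: ((-1) ^+ k) uu hk => u uu.
  move: (falling _ k) ('C(N, 2 * k)%:R : C) ('C(m, k)%:R : C) => F B b.
  move: (ecoef N (2 * k) sp) (ecoef N (2 * k) sq) (ecoef m k r) => a a' e.
  move: (k`!%:R / (2 * k)`!%:R : C) ((N ^_ k)%:R : C).
  move: ((N.+1 - k)%:R / N.+1%:R : C) => n2 v n1 hk B0 b0 hw.
  have {}hk : u * a' = F * e by rewrite hk mulKf.
  have -> : u * (B^-1 * (B^-1 * a * a') * (B * n1 * (u * (v * n2)))) =
    (u * a) * (u * a') * (B^-1 * v) * n1 * n2 by field.
  rewrite hk.
  have -> : u * a * (F * e) * (B^-1 * v) * n1 * n2 =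
    (B^-1 * F * v) * (u * a * e * n1 * n2) by ring.
  by rewrite hw; field; rewrite b0 expf_neq0 // pnatr_eq0.
split=> // x; rewrite /root (horner_evenQ _ mono fc_odd) => /eqP fx.
suff : 0 <= (2 * x) ^+ 2.
  by move/sqr_ge0_real; rewrite realMr ?pnatr_eq0 // realn.
apply: (proj2 hW); rewrite /root (horner_ecoef _ (proj1 hW)).
apply/eqP; rewrite -[RHS](mulr0 (4 ^+ m)) -[X in _ = _ * X]fx horner_poly_of_ecoef mulr_sumr.
apply: eq_bigr => k _; have km : (k <= m)%N by rewrite -ltnS.
rewrite key //.
have -> : ((2 * x) ^+ 2) ^+ (m - k) = 4 ^+ (m - k) * (x ^+ 2) ^+ (m - k) :> C.
  by rewrite -exprMn; congr (_ ^+ _); ring.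
have -> : 4 ^+ m = 4 ^+ (m - k) * 4 ^+ k :> C by rewrite -exprD subnK.
have : 4 ^+ k != 0 :> C by rewrite expf_neq0 ?pnatr_eq0.
by move: (4 ^+ k : C) (4 ^+ (m - k) : C) ((-1) ^+ k) => w w' u w0; field.
Qed.
End Main.

Theorem theorem5p6 (R : realType) (m : nat) (p q : {poly R[i]})
  (hm : (1 <= m)%N)
  (hp : monic_with_roots (2 * m) (@real_line R) p)
  (hq : monic_with_roots (2 * m) (@real_line R) q)
  (hqr : exists2 r : {poly R[i]}, monic_with_roots m (@nonneg_reals R) r &
           evenQ m (symmetrization (2 * m) q) =
           ffmul m (hypergeomH m (1 - (2 * m)%:R^-1)) r) :
  monic_with_roots (2 * m) (@real_line R) (ffcomm (2 * m) p q).
Proof.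
by case: hqr => r hr eqr; apply: ffcomm_real_rooted hm hp (proj1 hq) hr eqr.
Qed.
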